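(* If $G$ is a connected graph with $\mathrm{rank}_d(G)=3$, then $G$ is isomorphic to one of $K_3$, $P_3$, or $C_4$.
   Context: All graphs are finite and simple. For a connected graph $G$ with vertices $v_1,\dots,v_n$, $D(G)$ is the $n\times n$ matrix with $(i,j)$-entry the distance $d_G(v_i,v_j)$ (length of a shortest path), and $\mathrm{rank}_d(G)$ is the rank of $D(G)$. $K_3$ is the complete graph on 3 vertices, $P_3$ the path on 3 vertices, $C_4$ the cycle on 4 vertices. *)

(* Defs.v *)
From mathcomp Require Import all_boot all_order all_algebra.

Set Implicit Arguments.
Unset Strict Implicit.
Unset Printing Implicit Defensive.

Record sgraph := SGraph {
  svertex :> finType;
  sedge : rel svertex;
  sedge_sym : symmetric sedge;
  sedge_irrefl : irreflexive sedge
}.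

Definition connected_graph (G : sgraph) : Prop :=
  forall x y : G, connect (@sedge G) x y.

Definition graph_iso (G H : sgraph) : Prop :=
  exists2 f : G -> H, bijective f & forall x y, sedge (f x) (f y) = sedge x y.

(* There is a path (no repeated vertex) with k edges from x to y. *)
Definition path_of_length (G : sgraph) (x y : G) (k : nat) : bool :=
  [exists p : k.-tuple G,
    [&& path (@sedge G) x p, last x p == y & uniq (x :: p)]].

(* The least length of a path from x to y. Path lengths are smaller than
   #|G|, so the search range suffices; the value is #|G| when there is no
   path at all. *)
Definition gdist (G : sgraph) (x y : G) : nat :=
  find (path_of_length x y) (iota 0 #|G|).

Lemma path_of_length_lt (G : sgraph) (x y : G) k :
  path_of_length x y k -> k < #|G|.
Proof.
case/existsP=> p /and3P[_ _ /card_uniqP def_p].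
by have := max_card (mem (x :: p)); rewrite def_p /= size_tuple.
Qed.

Lemma gdist_path (G : sgraph) (x y : G) :
  connect (@sedge G) x y -> path_of_length x y (gdist x y).
Proof.
case/connectP=> p0 /shortenP[p e_p Up _] def_y.
have Hp : path_of_length x y (size p).
  by apply/existsP; exists (in_tuple p); rewrite e_p Up def_y eqxx.
have Hh : has (path_of_length x y) (iota 0 #|G|).
  apply/hasP; exists (size p) => //.
  by rewrite mem_iota add0n (path_of_length_lt Hp).
have := nth_find 0 Hh; rewrite nth_iota ?add0n //.
by rewrite -[X in _ < X](size_iota 0) -has_find.
Qed.

Lemma gdist_min (G : sgraph) (x : G) (p : seq G) :
  path (@sedge G) x p -> gdist x (last x p) <= size p.
Proof.
case/shortenP=> q e_q Uq /(uniq_leq_size (s2 := p)) le_qp.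
apply: leq_trans (le_qp _); last by case/andP: Uq.
have Hq : path_of_length x (last x q) (size q).
  by apply/existsP; exists (in_tuple q); rewrite e_q Uq eqxx.
have lt_q := path_of_length_lt Hq.
rewrite leqNgt; apply/negP => /(before_find 0).
by rewrite nth_iota // add0n Hq.
Qed.

(* D(G), with the vertices listed in the order of enum G. *)
Definition dist_mx (R : pzSemiRingType) (G : sgraph) : 'M[R]_#|G| :=
  (\matrix_(i, j) (gdist (enum_val i) (enum_val j))%:R)%R.

Definition dist_rank (R : fieldType) (G : sgraph) : nat := \rank (dist_mx R G).

Section Families.
Variable n : nat.

Definition complete_edge : rel 'I_n := [rel i j | i != j].

Definition path_edge : rel 'I_n :=
  [rel i j : 'I_n | (i.+1 == j :> nat) || (j.+1 == i :> nat)].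

(* The conjunct i != j only matters for the degenerate case n = 1. *)
Definition cycle_edge : rel 'I_n :=
  [rel i j : 'I_n | (i != j) &&
    ((i.+1 %% n == j :> nat) || (j.+1 %% n == i :> nat))].

Fact complete_edge_sym : symmetric complete_edge.
Proof. exact: (fun i j => congr1 negb (eq_sym i j)). Qed.
Fact complete_edge_irrefl : irreflexive complete_edge.
Proof. by move=> i; rewrite /complete_edge /= eqxx. Qed.
Fact path_edge_sym : symmetric path_edge.
Proof. by move=> i j; rewrite /path_edge /= orbC. Qed.
Fact path_edge_irrefl : irreflexive path_edge.
Proof. by move=> i; rewrite /path_edge /= gtn_eqF. Qed.
Fact cycle_edge_sym : symmetric cycle_edge.
Proof. by move=> i j; rewrite /cycle_edge /= eq_sym orbC. Qed.
Fact cycle_edge_irrefl : irreflexive cycle_edge.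
Proof. by move=> i; rewrite /cycle_edge /= eqxx. Qed.

Definition complete_graph := SGraph complete_edge_sym complete_edge_irrefl.
Definition path_graph := SGraph path_edge_sym path_edge_irrefl.
Definition cycle_graph := SGraph cycle_edge_sym cycle_edge_irrefl.

End Families.

(* Main.v *)
(* A symmetric 4 x 4 matrix with zero diagonal and opposite products
   a = d12 d34, b = d13 d24, c = d14 d23 has determinant
   a^2 + b^2 + c^2 - 2(ab + bc + ca), so this quantity vanishes on any four
   vertices when the distance matrix has rank 3.  It does not vanish on a
   vertex with three neighbours, where a, b, c are in {1, 2}, so degrees are at
   most 2; nor on a path w x y z whose ends are nonadjacent, so every path on
   four vertices closes up to a 4-cycle, which has no further neighbours and
   hence is the whole graph. *)
Require Import Defs.
From mathcomp Require Import all_boot all_order all_algebra.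
From mathcomp Require Import ring lra.

Set Implicit Arguments.
Unset Strict Implicit.
Unset Printing Implicit Defensive.

Import GRing.Theory.

(** Selecting rows and columns amounts to multiplying by row and column selections of the identity
    matrix, and multiplication cannot raise the rank. *)
Lemma mxrank_mxsub (F : fieldType) m n m' n' (f : 'I_m' -> 'I_m)
    (g : 'I_n' -> 'I_n) (A : 'M[F]_(m, n)) :
  \rank (mxsub f g A) <= \rank A.
Proof.
rewrite -[A in mxsub f g A]mulmx1 mxsub_mul.
apply: leq_trans (mxrankM_maxl _ _) _.
by rewrite -[A in rowsub f A]mul1mx -mul_rowsub_mx; apply: mxrankM_maxr.
Qed.

Lemma det_mx44_sym_hollow (R : comNzRingType) (F : nat -> nat -> R) :
  (forall i, F i i = 0)%R -> (forall i j, F i j = F j i) ->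
  let a := (F 0 1 * F 2 3)%R in
  let b := (F 0 2 * F 1 3)%R in
  let c := (F 0 3 * F 1 2)%R in
  (\det (\matrix_(i < 4, j < 4) F i j) =
     a ^+ 2 + b ^+ 2 + c ^+ 2 - (a * b + b * c + c * a) *+ 2)%R.
Proof.
move=> F0 Fsym a b c; rewrite /a /b /c {a b c}.
(* Each round expands the determinants along their first rows; three rounds go from size 4 down to
   size 1. *)
do 3 rewrite ?(expand_det_row _ ord0) ?big_ord_recl ?big_ord0 /cofactor.
rewrite !det_mx11 !mxE /=.
rewrite /bump /= !F0 (Fsym 1 0) (Fsym 2 0) (Fsym 3 0) (Fsym 2 1) (Fsym 3 1) (Fsym 3 2).
ring.
Qed.

Section Distance.
Variable G : sgraph.
Hypothesis Gconn : connected_graph G.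
Implicit Types x y z : G.

Lemma gdist_walk x y :
  exists2 p, path (@sedge G) x p & last x p = y /\ size p = gdist x y.
Proof.
have /existsP[p /and3P[xp /eqP lp _]] := gdist_path (Gconn x y).
by exists p => //; rewrite lp size_tuple.
Qed.

Lemma gdistxx x : gdist x x = 0.
Proof. by apply/eqP; rewrite -leqn0; apply: (@gdist_min G x [::]). Qed.

Lemma gdist_sym x y : gdist x y = gdist y x.
Proof.
suff le (u v : G) : gdist u v <= gdist v u by apply/eqP; rewrite eqn_leq !le.
have [p vp [lp <-]] := gdist_walk v u.
case: p vp lp => [|w p] vp lp; first by rewrite -lp gdistxx.
have := @gdist_min G u (rev (belast v (w :: p))).
rewrite -lp rev_path size_rev size_belast.
rewrite (eq_path (e' := @sedge G)); last by move=> s t; apply: sedge_sym.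
by move/(_ vp); rewrite /= rev_cons last_rcons.
Qed.

Lemma gdist_gt0 x y : (0 < gdist x y) = (x != y).
Proof.
have [-> | neq] := eqVneq x y; first by rewrite gdistxx.
have [p _ [lp <-]] := gdist_walk x y.
by case: p lp neq => //= ->; rewrite eqxx.
Qed.

Lemma edge_neq x y : sedge x y -> x != y.
Proof. by apply: contraTneq => ->; rewrite sedge_irrefl. Qed.

Lemma gdist_eq1 x y : (gdist x y == 1) = sedge x y.
Proof.
apply/eqP/idP => [d1 | exy].
  have [p xp [lp]] := gdist_walk x y; rewrite d1.
  by case: p xp lp => [|z []] //= xz <- _; rewrite andbT in xz.
apply/eqP; rewrite eqn_leq gdist_gt0 edge_neq // andbT.
by have /= := @gdist_min G x [:: y]; rewrite exy; apply.
Qed.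

Lemma gdist_common_neighbor x y z :
  sedge y x -> sedge y z -> x != z -> gdist x z = if sedge x z then 1 else 2.
Proof.
move=> eyx eyz neq; case: ifP => [|/negbT].
  by rewrite -gdist_eq1 => /eqP.
have := @gdist_min G x [:: y; z]; rewrite /= sedge_sym eyx eyz => /(_ isT).
by rewrite -gdist_eq1; move: neq; rewrite -gdist_gt0; case: gdist => [|[|[|]]].
Qed.

(** If no edge left [s], every walk from [x] would stay in [s], which would then contain all
    vertices. This supplies the new vertex each time a configuration is enlarged. *)
Lemma connected_exit (s : seq G) x :
  x \in s -> size s < #|G| ->
  exists2 y, y \in s & exists2 z, z \notin s & sedge y z.
Proof.
move=> xs ltsG.
case: (boolP [exists y in s, exists z, (z \notin s) && sedge y z]).
  by case/exists_inP=> y ys /existsP[z /andP[zs e]]; exists y => //; exists z.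
move/exists_inPn=> closed; suff: #|G| <= size s by rewrite leqNgt ltsG.
apply: leq_trans (card_size s); apply/subset_leq_card/subsetP => z _.
have /connectP[p xp ->] := Gconn x z.
elim: p x xs xp => //= y p IHp x xs /andP[exy yp]; apply: IHp yp.
have /existsPn/(_ y) := closed _ xs.
by rewrite exy andbT negbK.
Qed.

(** Indexing into [s] is injective between sets of equal size, hence bijective; its inverse is the
    isomorphism. *)
Lemma graph_iso_seq n (s : seq G) (e : rel 'I_n) e_sym e_irrefl x0 :
  uniq s -> size s = n -> #|G| = n ->
  (forall i j : 'I_n, sedge (nth x0 s i) (nth x0 s j) = e i j) ->
  graph_iso G (@SGraph 'I_n e e_sym e_irrefl).
Proof.
move=> Us sz cardG es; pose g (i : 'I_n) := nth x0 s i.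
have inj_g : injective g.
  move=> i j /eqP; rewrite /g nth_uniq ?sz // => /eqP; exact: val_inj.
have bij_g : bijective g by apply: inj_card_bij; rewrite // card_ord cardG.
have [f gK fK] := bij_g; exists f; first by exists g.
by move=> x y /=; rewrite -es -/(g _) -/(g _) !fK.
Qed.

Section Rank3.
Variable R : realFieldType.
Hypothesis Grank : dist_rank R G = 3.

Lemma rank3_four_points (w x y z : G) :
  let a := ((gdist w x)%:R * (gdist y z)%:R : R)%R in
  let b := ((gdist w y)%:R * (gdist x z)%:R : R)%R in
  let c := ((gdist w z)%:R * (gdist x y)%:R : R)%R in
  (a ^+ 2 + b ^+ 2 + c ^+ 2 - (a * b + b * c + c * a) *+ 2 = 0)%R.
Proof.
pose v := nth w [:: w; x; y; z].
pose F i j : R := (gdist (v i) (v j))%:R%R.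
have F0 i : F i i = 0%R by rewrite /F gdistxx.
have Fsym i j : F i j = F j i by rewrite /F gdist_sym.
rewrite /= -(@det_mx44_sym_hollow _ F) //.
have -> : (\matrix_(i < 4, j < 4) F i j =
    mxsub (fun i : 'I_4 => enum_rank (v i)) (fun i : 'I_4 => enum_rank (v i))
          (dist_mx R G))%R.
  by apply/matrixP=> i j; rewrite !mxE !enum_rankK.
(* A nonzero determinant would mean rank 4 for a submatrix of a matrix of rank 3. *)
apply/eqP; rewrite -[_ == _]negbK -unitfE -unitmxE -row_free_unit -row_leq_rank.
rewrite -ltnNge ltnS -Grank; exact: mxrank_mxsub.
Qed.

Lemma rank3_degree (x a b c : G) :
  sedge x a -> sedge x b -> sedge x c -> ~~ uniq [:: a; b; c].
Proof.
move=> xa xb xc; apply/negP; rewrite /= !inE negb_or andbT.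
case/andP=> /andP[ab ac] bc.
have := rank3_four_points x a b c.
rewrite (gdist_common_neighbor xa xb) // (gdist_common_neighbor xa xc) //.
rewrite (gdist_common_neighbor xb xc) //.
move: xa xb xc; rewrite -!gdist_eq1 => /eqP-> /eqP-> /eqP->.
(* The three products are the distances among [a], [b], [c]. With one to three of them raised from 1
   to 2 the value is -4, -7 or -12, and -3 with none. *)
by do 3 case: ifP => _ /=; lra.
Qed.

Lemma rank3_path4_closed (w x y z : G) :
  uniq [:: w; x; y; z] -> sedge w x -> sedge x y -> sedge y z ->
  [/\ sedge w z, ~~ sedge w y & ~~ sedge x z].
Proof.
rewrite /= !inE !negb_or !andbT.
case/and3P=> /and3P[nwx nwy nwz] /andP[nxy nxz] nyz wx xy yz.
have xw : sedge x w by rewrite sedge_sym.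
have yx : sedge y x by rewrite sedge_sym.
have nWY : ~~ sedge w y.
  apply/negP; rewrite sedge_sym => yw; have := rank3_degree yw yx yz.
  by rewrite /= !inE !negb_or nwx nwz nxz.
have nXZ : ~~ sedge x z.
  apply/negP=> xz; have := rank3_degree xw xy xz.
  by rewrite /= !inE !negb_or nwy nwz nyz.
split=> //; apply/idPn => nWZ.
(* Without chords [w y] and [x z] the products are 1, 4 and t, where t is the distance from [w] to
   [z]. The identity reads (t - 1)(t - 9) = 0, while the path gives t <= 3. *)
have := rank3_four_points w x y z.
rewrite (gdist_common_neighbor xw xy) // (gdist_common_neighbor yx yz) //.
rewrite (negPf nWY) (negPf nXZ).
have := @gdist_min G w [:: x; y; z]; rewrite /= wx xy yz => /(_ isT).
move: nwz nWZ; rewrite -gdist_gt0 -gdist_eq1.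
move: wx xy yz; rewrite -!gdist_eq1 => /eqP-> /eqP-> /eqP->.
by case: gdist => [|[|[|[|]]]] //= _ _ _; lra.
Qed.

Lemma rank3_card_ge3 : 2 < #|G|.
Proof. by rewrite -Grank; apply: rank_leq_row. Qed.

Lemma exists_path3 :
  exists x y z : G, [/\ uniq [:: x; y; z], sedge x y & sedge y z].
Proof.
have G3 := rank3_card_ge3.
have /card_gt0P[a _] : 0 < #|G| by apply: leq_trans G3.
have [||_ /[!inE]/eqP-> [b + ab]] := @connected_exit [:: a] a.
- by rewrite inE.
- exact: leq_trans G3.
rewrite inE => nba.
have [|x + [c + xc]] := @connected_exit [:: a; b] a _ G3.
  by rewrite inE eqxx.
rewrite !inE negb_or => xab /andP[nca ncb].
(* Whichever end of the edge [a b] the third vertex [c] is attached to becomes the middle of the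
   path. *)
case/orP: xab xc => /eqP-> ec; last first.
  by exists a, b, c; rewrite /= !inE negb_or ![_ == c]eq_sym eq_sym nba nca ncb.
exists b, a, c; rewrite sedge_sym.
by rewrite /= !inE negb_or ![_ == c]eq_sym nba nca ncb.
Qed.

Lemma exists_path4 : 3 < #|G| ->
  exists w x y z : G,
    [/\ uniq [:: w; x; y; z], sedge w x, sedge x y & sedge y z].
Proof.
move=> G4; have [x [y [z [Uxyz xy yz]]]] := exists_path3.
have [|t + [d dxyz td]] := @connected_exit [:: x; y; z] x _ G4.
  by rewrite inE eqxx.
rewrite !inE => /or3P[] /eqP def_t; rewrite {}def_t in td.
- by exists d, x, y, z; rewrite cons_uniq dxyz Uxyz sedge_sym.
(* Attached to the middle vertex [y], [d] would be its third neighbour; attached to an end, it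
   extends the path. *)
- rewrite sedge_sym in xy; have := rank3_degree xy yz td.
  move: Uxyz dxyz; rewrite /= !inE !negb_or.
  by rewrite ![d == _]eq_sym => /and3P[/andP[_ ->] _ _] /and3P[-> _ ->].
- exists x, y, z, d; split=> //.
  by rewrite -[_ :: _]/(rcons [:: x; y; z] d) rcons_uniq dxyz.
Qed.

(** The path closes to a 4-cycle, so each of its vertices already has two neighbours on it, and a
    fifth vertex attached to it would be a third. *)
Lemma rank3_path4_card (w x y z : G) :
  uniq [:: w; x; y; z] -> sedge w x -> sedge x y -> sedge y z -> #|G| = 4.
Proof.
move=> U wx xy yz; have [wz _ _] := rank3_path4_closed U wx xy yz.
have [xw [yx [zy zw]]] : [/\ sedge x w, sedge y x, sedge z y & sedge z w].
  by rewrite ![sedge x w]sedge_sym [sedge y x]sedge_sym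
     [sedge z y]sedge_sym [sedge z w]sedge_sym.
have G4 : 3 < #|G| by rewrite -[4]/(size [:: w; x; y; z]) -(card_uniqP U) max_card.
apply/eqP; rewrite eqn_leq G4 andbT leqNgt.
apply/negP=> G5; have [|t + [d + td]] := @connected_exit [:: w; x; y; z] w _ G5.
  by rewrite inE eqxx.
move: U; rewrite /= !inE !negb_or !andbT.
case/and3P=> /and3P[nwx nwy nwz] /andP[nxy nxz] nyz.
move=> + /and4P[dw dx dy dz].
by case/or4P=> /eqP def_t; rewrite {}def_t in td;
  [have := rank3_degree td wx wz | have := rank3_degree td xw xy
  |have := rank3_degree td yx yz | have := rank3_degree td zw zy];
  rewrite /= !inE !negb_or ?dw ?dx ?dy ?dz ?nxz ?nwy.
Qed.

End Rank3.
End Distance.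

Theorem theorem6 (R : realFieldType) (G : sgraph)
  (Gconn : connected_graph G) (Grank : dist_rank R G = 3) :
  graph_iso G (complete_graph 3) \/
  graph_iso G (path_graph 3) \/
  graph_iso G (cycle_graph 4).
Proof.
have [G4 | G3] := ltnP 3 #|G|.
  have [w [x [y [z [U wx xy yz]]]]] := exists_path4 Gconn Grank G4.
  have [wz wy xz] := rank3_path4_closed Gconn Grank U wx xy yz.
  right; right; apply: (@graph_iso_seq _ _ [:: w; x; y; z] _ _ _ w) => //.
    exact (rank3_path4_card Gconn Grank U wx xy yz).
  (* The list follows the cyclic order, so all 16 index pairs can be compared directly; the final
     [sedge_sym] serves the reversed edges. *)
  by case=> [[|[|[|[|i]]]] // ?] [[|[|[|[|j]]]] // ?] /=;
    rewrite ?sedge_irrefl // ?wx ?xy ?yz ?wz ?(negPf wy) ?(negPf xz) //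
      sedge_sym ?wx ?xy ?yz ?wz ?(negPf wy) ?(negPf xz).
have [x [y [z [U xy yz]]]] := exists_path3 Gconn Grank.
have cardG : #|G| = 3.
  by apply/eqP; rewrite eqn_leq G3; exact: rank3_card_ge3 Grank.
(* On three vertices only the pair of ends of the path is undecided: adjacent gives the triangle,
   nonadjacent the path. *)
case xz: (sedge x z); [left | right; left];
  apply: (@graph_iso_seq _ _ [:: x; y; z] _ _ _ x) => //;
  by case=> [[|[|[|i]]] // ?] [[|[|[|j]]] // ?] /=;
    rewrite ?sedge_irrefl // ?xy ?yz ?xz // sedge_sym ?xy ?yz ?xz.
Qed.
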